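(* There is a polynomial $p$ such that for every pointed dag $G$, every $k\ge 1$, and every guard function $\rho$ (as in the context), the guarded xor-ified pebbling formula $\mathrm{GPeb}^{k\oplus}(G)$ has a regRTI refutation, and hence a pool resolution refutation, with at most $p(N)$ clauses, where $N$ is the size of $\mathrm{GPeb}^{k\oplus}(G)$.
   Context: A pointed dag $G=(V,E)$ is a directed acyclic graph with a single sink $t$ in which every vertex has indegree $0$ or $2$. $\mathrm{Peb}(G)$ is the set of clauses over variables $x_v$ ($v\in V$): ($\alpha$) $x_s$ for each source $s$; ($\beta$) $\overline x_u\lor\overline x_v\lor x_w$ for each vertex $w$ with predecessors $u,v$; ($\gamma$) $\overline x_t$. Xor-ification: fix $k>0$; each $x_u$ gets variables $x_{u,1},\dots,x_{u,k}$; with $y^1=y$, $y^{-1}=\overline y$, let $x_u^{k\oplus}$ be the set of clauses $x_{u,1}^{i_1}\lor\cdots\lor x_{u,k}^{i_k}$ with an even number of $i_j$ equal to $-1$, and $\overline x_u^{k\oplus}$ the same with an odd number equal to $-1$. For a clause $C=z_1\lor\cdots\lor z_\ell$ with each $z_i$ of the form $x_u$ or $\overline x_u$, $C^{k\oplus}$ is the set of clauses $C_1\lor\cdots\lor C_\ell$ with $C_i\in z_i^{k\oplus}$. $\mathrm{Peb}^{k\oplus}(G)$ is the union of $C^{k\oplus}$ over $C\in\mathrm{Peb}(G)$. Let $\rho$ map each clause $C$ of $\mathrm{Peb}^{k\oplus}(G)$ to a variable $x_{u,i}$ not occurring in $C$. $\mathrm{GPeb}^{k\oplus}(G)$ consists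 of the clauses $C\lor\rho(C)$ and $C\lor\overline{\rho(C)}$ for $C\in\mathrm{Peb}^{k\oplus}(G)$. Resolution derives $A'\lor B'$ from $A'\lor x$ and $B'\lor\overline x$. A pool resolution refutation of a set $F$ is a finite binary tree of clauses with the empty clause at the root, each internal node the resolvent of its two children, each leaf either a member of $F$ or a clause (''lemma'') labeling a node earlier in postorder (for a node $u$, nodes $v$ in its left subtree and $w$ in its right subtree satisfy $v<w<u$), and along every root-to-leaf path each variable is resolved on at most once. A regRTI refutation is a pool resolution refutation in which every lemma is an input lemma: the conclusion of an earlier subderivation in which every inference has at least one hypothesis that is in $F$ or a lemma. *)

(* Defs.v *)
From HB Require Import structures.
From mathcomp Require Import all_boot all_order all_algebra.

Set Implicit Arguments.
Unset Strict Implicit.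
Unset Printing Implicit Defensive.

(* [(x, true)] is the literal x and [(x, false)] its negation. *)
Definition lit (X : finType) : finType := (X * bool)%type.
Definition clause (X : finType) : finType := {set lit X}.
Definition cnf (X : finType) : finType := {set clause X}.

(* Total number of literal occurrences. *)
Definition cnf_size (X : finType) (F : cnf X) : nat := \sum_(C in F) #|C|.

Record pointed_dag : Type := PointedDag {
  vertex :> finType;
  edge : rel vertex;
  edge_acyclic : forall p : seq vertex, cycle edge p -> p = [::];
  sink : vertex;
  sink_unique : forall v, [forall w, ~~ edge v w] = (v == sink);
  indegree02 : forall v, #|[set u | edge u v]| \in [:: 0; 2]
}.

Definition preds (G : pointed_dag) (v : G) : {set G} := [set u | edge u v].

Definition is_source (G : pointed_dag) (v : G) : bool := preds v == set0.

Definition Peb (G : pointed_dag) : cnf G :=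
  [set [set (s, true)] | s : G & is_source s]
  :|: [set (w, true) |: [set (u, false) | u in preds w] | w : G & ~~ is_source w]
  :|: [set [set (sink G, false)]].

Definition xor_var (X : finType) (k : nat) : finType := (X * 'I_k)%type.

(* A choice of signs [i_1, ..., i_k] is a function [s], with [s j = false]
   standing for [i_j = -1]. *)
Definition xor_lit (X : finType) (k : nat) (z : lit X) : cnf (xor_var X k) :=
  [set [set ((z.1, j), s j) | j : 'I_k]
    | s : {ffun 'I_k -> bool} & odd #|[set j | ~~ s j]| == ~~ z.2].

Definition xor_clause (X : finType) (k : nat) (C : clause X) :
    cnf (xor_var X k) :=
  [set \bigcup_(z in C) f z
    | f : {ffun lit X -> clause (xor_var X k)}
    & [forall z in C, f z \in xor_lit k z]].

Definition xor_Peb (G : pointed_dag) (k : nat) : cnf (xor_var G k) :=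
  \bigcup_(C in Peb G) xor_clause k C.

(* The values of [rho] outside [xor_Peb G k] are irrelevant. *)
Definition guard_function (G : pointed_dag) (k : nat)
    (rho : clause (xor_var G k) -> xor_var G k) : Prop :=
  forall C, C \in xor_Peb G k -> forall b : bool, (rho C, b) \notin C.

Definition GPeb (G : pointed_dag) (k : nat)
    (rho : clause (xor_var G k) -> xor_var G k) : cnf (xor_var G k) :=
  [set (rho C, true) |: C | C in xor_Peb G k]
  :|: [set (rho C, false) |: C | C in xor_Peb G k].

(* Each node carries its clause; an internal node also carries the variable
   resolved on, which the clauses alone need not determine. *)
Inductive rtree (X : finType) : Type :=
| Leaf of clause X
| Node of X & clause X & rtree X & rtree X.

Arguments Leaf {X}.
Arguments Node {X}.

Definition concl (X : finType) (t : rtree X) : clause X :=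
  match t with Leaf C => C | Node _ C _ _ => C end.

Definition is_leaf (X : finType) (t : rtree X) : bool := if t is Leaf _ then true else false.

Definition resolvent (X : finType) (x : X) (A B C : clause X) : bool :=
  [&& (x, true) \in A, (x, false) \in B &
      C == (A :\ (x, true)) :|: (B :\ (x, false))].

(* The positive occurrence of the variable may be in either child, since the
   left-to-right order of children determines which lemmas are available. *)
Fixpoint correct_inferences (X : finType) (t : rtree X) : bool :=
  match t with
  | Leaf _ => true
  | Node x C l r =>
      [&& resolvent x (concl l) (concl r) C || resolvent x (concl r) (concl l) C,
          correct_inferences l & correct_inferences r]
  end.

(* The nodes in postorder, each represented by the subtree rooted at it. *)
Fixpoint postorder (X : finType) (t : rtree X) : seq (rtree X) :=
  match t with
  | Leaf _ => [:: t]
  | Node _ _ l r => postorder l ++ postorder r ++ [:: t]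
  end.

Definition num_clauses (X : finType) (t : rtree X) : nat := size (postorder t).

(* The variables resolved on along each root-to-leaf path. *)
Fixpoint branches (X : finType) (t : rtree X) : seq (seq X) :=
  match t with
  | Leaf _ => [:: [::]]
  | Node x _ l r => [seq x :: b | b <- branches l ++ branches r]
  end.

Definition regular (X : finType) (t : rtree X) : bool := all uniq (branches t).

Definition pool_leaves (X : finType) (F : cnf X) (t : rtree X) : Prop :=
  forall s1 C s2, postorder t = s1 ++ Leaf C :: s2 ->
    (C \in F) || has (fun u => concl u == C) s1.

Definition pool_refutation (X : finType) (F : cnf X) (t : rtree X) : Prop :=
  [/\ concl t = set0, correct_inferences t, regular t & pool_leaves F t].

(* The hypotheses of an inference that are in F or lemmas are its children
   that are leaves. *)
Fixpoint input_derivation (X : finType) (t : rtree X) : bool :=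
  match t with
  | Leaf _ => true
  | Node _ _ l r =>
      [&& is_leaf l || is_leaf r, input_derivation l & input_derivation r]
  end.

Definition input_lemmas (X : finType) (F : cnf X) (t : rtree X) : Prop :=
  forall s1 C s2, postorder t = s1 ++ Leaf C :: s2 ->
    (C \in F) || has (fun u => input_derivation u && (concl u == C)) s1.

Definition regRTI_refutation (X : finType) (F : cnf X) (t : rtree X) : Prop :=
  pool_refutation F t /\ input_lemmas F t.

(* Main.v *)
(** The unguarded formula has a regular refutation of polynomial size, obtained by
    querying the blocks of variables down the dag from the sink.  Guards get in
    the way when [rho C] has been resolved on before [C] is needed.

    A state of the search is a set [S] of queried vertices and a goal [g] in [S]
    known to be false, such that every vertex of [S] with an edge into the part of
    the dag below [g] outside [S] is true.  Any vertex [w] of that part may be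
    queried next: if [w] is false it becomes the goal, otherwise [g] remains the
    goal.  Since [w] is relevant to both continuations, no inference is degenerate.

    Call a clause [C] about a vertex below [g] usable if [C] is already an input
    lemma or [rho C] is a variable of [S]; in the second case one of the two
    guarded versions of [C] can be used, as its extra literal is falsified by the
    path.  If all such [C] are usable, the standard refutation finishes the state.
    Otherwise an unusable [C] can be learned at once: query its vertex and then the
    predecessors, which does not touch [rho C].  This leaves at most [2 ^ (3 * k)]
    new states, and it happens at most once per clause. *)

From HB Require Import structures.
Require Import Defs.
From mathcomp Require Import all_boot all_order all_algebra zify.

Set Implicit Arguments.
Unset Strict Implicit.
Unset Printing Implicit Defensive.

(** * Lemma availability, regularity and height of proof trees *)

Section Trees.

Variables (X : finType) (F : cnf X).

Implicit Types (t l r : rtree X) (C D : clause X) (L : {set clause X}).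

Definition learned (s : seq (rtree X)) : {set clause X} :=
  [set C | has (fun u => input_derivation u && (concl u == C)) s].

Lemma learned_cat s s' : learned (s ++ s') = learned s :|: learned s'.
Proof. by apply/setP=> C; rewrite !inE has_cat. Qed.

Definition lemmas t := learned (postorder t).

Lemma lemmas_node x C l r :
  lemmas (Node x C l r) = lemmas l :|: lemmas r :|: learned [:: Node x C l r].
Proof. by rewrite /lemmas /= !learned_cat setUA. Qed.

Lemma lemmas_root t : input_derivation t -> concl t \in lemmas t.
Proof.
case: t => [C|x C l r] It; rewrite ?lemmas_node ?inE; first by rewrite /= eqxx.
by rewrite has_seq1 It eqxx orbT.
Qed.

(* [L] is the set of lemmas available before the first node of the tree. *)
Fixpoint valid L t : bool :=
  match t with
  | Leaf C => C \in F :|: L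
  | Node _ _ l r => valid L l && valid (L :|: lemmas l) r
  end.

(** [valid] follows the tree, while [input_lemmas] cuts the postorder at an arbitrary leaf; this
    version on lists splits at any cut. *)
Fixpoint valid_seq L (s : seq (rtree X)) : bool :=
  if s is u :: s' then
    (if u is Leaf C then C \in F :|: L else true)
    && valid_seq (L :|: learned [:: u]) s'
  else true.

Lemma valid_seq_cat L s s' :
  valid_seq L (s ++ s') = valid_seq L s && valid_seq (L :|: learned s) s'.
Proof.
elim: s L => [|u s IH] L /=.
  by congr valid_seq; apply/setP=> C; rewrite !inE orbF.
by rewrite IH -andbA -setUA -learned_cat.
Qed.

Lemma valid_postorder L t : valid L t -> valid_seq L (postorder t).
Proof.
elim: t L => [C|x C l IHl r IHr] L /=; first by rewrite andbT.
case/andP=> /IHl vl /IHr vr; rewrite !valid_seq_cat vl /=.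
by rewrite -/(lemmas l) vr.
Qed.

Lemma valid_input_lemmas t : valid set0 t -> input_lemmas F t.
Proof.
move=> /valid_postorder v s1 C s2 E; move: v.
rewrite E valid_seq_cat /= => /and3P[_ + _].
by rewrite !inE.
Qed.

Lemma input_pool_leaves t : input_lemmas F t -> pool_leaves F t.
Proof.
move=> v s1 C s2 /v /orP[->//|h]; apply/orP; right.
by apply: sub_has h => u /andP[].
Qed.

(* [V] contains the variables resolved on below the tree. *)
Fixpoint reg (V : {set X}) t : bool :=
  match t with
  | Leaf _ => true
  | Node x _ l r => [&& x \notin V, reg (x |: V) l & reg (x |: V) r]
  end.

Lemma reg_sub (V W : {set X}) t : W \subset V -> reg V t -> reg W t.
Proof.
elim: t V W => [//|x C l IHl r IHr] V W sWV /= /and3P[xV hl hr].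
rewrite (contra (subsetP sWV x) xV) /=.
by rewrite (IHl (x |: V)) ?setUS //= (IHr (x |: V)) ?setUS.
Qed.

Lemma reg_branches V t :
  reg V t -> all (fun b => uniq b && all (fun x => x \notin V) b) (branches t).
Proof.
elim: t V => [//|x C l IHl r IHr] V /= /and3P[xV /IHl hl /IHr hr].
rewrite all_map all_cat.
have sub b : uniq b && all (fun y => y \notin x |: V) b ->
    uniq (x :: b) && all (fun y => y \notin V) (x :: b).
  case/andP=> ub /allP ab /=; rewrite xV ub andbT /=; apply/andP; split.
    by apply/negP=> /ab; rewrite !inE eqxx.
  by apply/allP=> y /ab; rewrite !inE negb_or => /andP[].
by apply/andP; split; [apply: sub_all hl|apply: sub_all hr] => b /sub.
Qed.

Lemma reg_regular t : reg set0 t -> regular t.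
Proof. by move/reg_branches; apply: sub_all => b /andP[]. Qed.

Lemma num_node x C l r :
  num_clauses (Node x C l r) = num_clauses l + num_clauses r + 1.
Proof. by rewrite /num_clauses /= !size_cat addnA. Qed.

Fixpoint height t : nat :=
  if t is Node _ _ l r then (maxn (height l) (height r)).+1 else 0.

Lemma reg_height V t : reg V t -> height t + #|V| <= #|X|.
Proof.
elim: t V => [C|x C l IHl r IHr] V /=; first by move=> _; exact: max_card.
case/and3P=> xV /IHl + /IHr.
by rewrite !cardsU1 xV add1n addSnnS addn_maxl geq_max => -> ->.
Qed.

Fixpoint leaves_in (A : {set clause X}) t : bool :=
  match t with
  | Leaf C => C \in A
  | Node _ _ l r => leaves_in A l && leaves_in A r
  end.

(* The height of the part of the tree whose clauses are still to be learned. *)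
Fixpoint pending L t : nat :=
  match t with
  | Leaf _ => 0
  | Node _ C l r =>
      if C \in F :|: L then 0 else (maxn (pending L l) (pending L r)).+1
  end.

Lemma pending_height L t : pending L t <= height t.
Proof. by elim: t => //= x C l IHl r IHr; case: ifP => // _; lia. Qed.

Lemma pending_mono L L' t : L \subset L' -> pending L' t <= pending L t.
Proof.
move=> sLL'; elim: t => //= x C l IHl r IHr.
case: ifP => // nL'; case: ifP => [iL|_]; last by lia.
by move/negP: nL' => []; apply: (subsetP (setUS F sLL')).
Qed.

Definition tree_eq_dec t t' : {t = t'} + {t <> t'}.
Proof. by decide equality; apply: eq_comparable. Defined.

End Trees.

HB.instance Definition _ (X : finType) :=
  hasDecEq.Build (rtree X) (compareP (@tree_eq_dec X)).

(** * From regular resolution dags to trees with input lemmas *)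

Section InputLemmas.

Variables (X : finType) (F : cnf X).

Implicit Types (t l r : rtree X) (C D : clause X) (L : {set clause X}).

(** Such a list stands for a resolution dag, with one entry for each distinct subderivation. *)
Definition subtree_closed (ts : seq (rtree X)) :=
  forall x C l r, Node x C l r \in ts -> (l \in ts) && (r \in ts).

(** The budget of the simulation below. The height bound lets a node be charged separately from its
    children, whose expansion is charged to trees of smaller height. *)
Definition potential (ts : seq (rtree X)) (n : nat) L :=
  \sum_(t <- ts | height t <= n) pending F L t.

(** Term by term, pending heights only fall as lemmas are added; a tree of height strictly above [m]
    that is affected gives one extra unit at level [n]. *)
Lemma potential_drop ts m n L L' : m <= n -> L \subset L' ->
  potential ts m L + potential ts n L'
    + has (fun t => (m < height t <= n) && (pending F L' t < pending F L t)) ts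
  <= potential ts n L + potential ts m L'.
Proof.
move=> mn sLL'; elim: ts => [|t ts IH]; first by rewrite /potential !big_nil.
move: IH; rewrite /potential /= !big_cons.
have := pending_mono F t sLL'.
move: (\sum_(_ <- _ | _) _) (\sum_(_ <- _ | _) _) (\sum_(_ <- _ | _) _)
  (\sum_(_ <- _ | _) _) (has _ _) => a b c d e.
by case: (leqP (height t) m) => h1; case: (leqP (height t) n) => h2;
  case: (leqP (pending F L t) (pending F L' t)) => h3; case: e => /=; lia.
Qed.

Lemma potential_mono ts n L L' : L \subset L' -> potential ts n L' <= potential ts n L.
Proof. by move=> sLL'; apply: leq_sum => t _; apply: pending_mono. Qed.

Lemma potential_bound ts n L : potential ts n L <= size ts * n.
Proof.
elim: ts => [|t ts IH]; first by rewrite /potential big_nil.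
rewrite /potential big_cons /= mulSn; case: (leqP (height t) n) => h; last first.
  exact: leq_trans IH (leq_addl _ _).
exact: leq_add (leq_trans (pending_height _ _ _) h) IH.
Qed.

(* Every expansion of a tree lowers its pending height, so a tree is expanded at
   most as many times as its height before its conclusion is an input lemma. *)
Lemma input_lemma_simulation ts L0 t L V :
  subtree_closed ts -> t \in ts -> correct_inferences t -> reg V t ->
  leaves_in (F :|: L0) t -> L0 \subset L ->
  exists t', [/\ concl t' = concl t, correct_inferences t', reg V t', valid F L t'
    & [/\ num_clauses t' + 2 * potential ts (height t) (L :|: lemmas t')
           <= 1 + 2 * potential ts (height t) L,
          pending F (L :|: lemmas t') t <= (pending F L t).-1
        & pending F L t = 0 -> is_leaf t']].
Proof.
move=> cl; elim: t L V => [C|x C l IHl r IHr] L V tin.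
  move=> _ _ /= CF sL; exists (Leaf C); split=> //=.
    by apply: (subsetP (setUS F sL)).
  by split=> //; rewrite leq_add ?leq_mul ?potential_mono ?subsetUl.
move=> /= /and3P[ok okl okr] /and3P[xV rl rr] /andP[ll lr] sL.
have /andP[lin rin] := cl _ _ _ _ tin.
case: ifP => [CL|nCL].
  exists (Leaf C); split=> //=; split=> //; last first.
    by rewrite (subsetP (setUS F (subsetUl L _)) _ CL).
  by rewrite leq_add ?leq_mul ?potential_mono ?subsetUl.
have [l' [cl' okl' rl' vl' [nl pl il]]] := IHl L _ lin okl rl ll sL.
set L1 := L :|: lemmas l' in nl pl.
have sL1 : L \subset L1 by apply: subsetUl.
have [r' [cr' okr' rr' vr' [nr pr ir]]] := IHr L1 _ rin okr rr lr (subset_trans sL sL1).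
set L2 := L1 :|: lemmas r' in nr pr.
have sL2 : L1 \subset L2 by apply: subsetUl.
set t' := Node x C l' r'; set L3 := L :|: lemmas t'.
have L3E : L3 = L2 :|: learned [:: t'] by rewrite /L3 lemmas_node /L2 /L1 !setUA.
have sL3 : L2 \subset L3 by rewrite L3E subsetUl.
have sLL2 := subset_trans sL1 sL2.
have pend : pending F L3 (Node x C l r) <= maxn (pending F L l) (pending F L r).
  rewrite /=; case: ifP => // nC3.
  have ml := pending_mono F l (subset_trans sL2 sL3).
  have mr := pending_mono F r sL3.
  have mr1 := pending_mono F r sL1.
  (* A pending premise has been lowered by its own expansion, so the maximum falls. *)
  case: (posnP (maxn (pending F L l) (pending F L r))) => [m0|]; last first.
    by move: ml pl mr pr mr1; clear; lia.
  (* both premises are available, so the inference is a new input lemma *)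
  have lf : is_leaf l' by apply: il; move: m0; clear; lia.
  have rf : is_leaf r' by apply: ir; move: m0 mr1; clear; lia.
  suff : C \in L3 by move=> CL3; rewrite in_setU CL3 orbT in nC3.
  rewrite L3E !inE has_seq1 /= lf eqxx andbT /=.
  by case: (l') lf => // ? _; case: (r') rf => // ? _; rewrite orbT.
exists t'; split=> //=.
- by rewrite cl' cr' ok okl'.
- by rewrite xV rl'.
- by rewrite vl'.
- split; [|exact: pend|by []].
set h := maxn (height l) (height r).
have d1 := potential_drop ts (leq_maxl _ _ : height l <= h) sL1.
have d2 := potential_drop ts (leq_maxr _ _ : height r <= h) sL2.
have d3 := potential_mono ts h sL3.
(* The node and its two children contribute constants adding up to 3. The node, of height [h.+1],
   loses a unit of pending height, and twice this unit pays for the excess over 1. *)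
have := potential_drop ts (leqnSn h) (subset_trans sLL2 sL3).
have -> : has (fun t => (h < height t <= h.+1) && (pending F L3 t < pending F L t)) ts.
  apply/hasP; exists (Node x C l r) => //=.
  rewrite !leqnn /=; move: pend => /=; rewrite nCL; clear; lia.
rewrite num_node -/L3; move: d1 d2 d3 nl nr; clear; lia.
Qed.

(** Regularity bounds the height of [t] by the number of variables, so each tree of [ts] contributes
    at most [#|X|] to the initial potential. *)
Corollary input_lemma_compression ts t L V :
  subtree_closed ts -> t \in ts -> correct_inferences t -> reg V t ->
  leaves_in (F :|: L) t ->
  exists t', [/\ concl t' = concl t, correct_inferences t', reg V t', valid F L t'
    & num_clauses t' <= 1 + 2 * (size ts * #|X|)].
Proof.
move=> cl tin okt rt lt.
have [t' [ct' okt' rt' vt' [nt' _ _]]] := input_lemma_simulation cl tin okt rt lt (subxx L).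
exists t'; split=> //; apply: leq_trans (leq_addr _ _) (leq_trans nt' _).
rewrite leq_add2l leq_mul // (leq_trans (potential_bound _ _ _)) // leq_mul //.
exact: leq_trans (leq_addr _ _) (reg_height rt).
Qed.
End InputLemmas.

(** * Ranks, and paths avoiding the queried vertices *)

Section Dag.

Variable G : pointed_dag.

Implicit Types (S : {set G}) (g p r u v w : G).

Lemma edge_connect_acyclic v w : edge v w -> ~~ connect (@edge G) w v.
Proof.
move=> evw; apply/connectP=> -[p pwp E].
have := edge_acyclic (p := w :: p); rewrite /= rcons_path pwp -E evw.
by move=> /(_ isT).
Qed.

Lemma edge_irrefl v : edge v v = false.
Proof. by apply/negP=> /edge_connect_acyclic; rewrite connect0. Qed.

(** A topological numbering: it orders the queries and delimits the blocks that a shared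
    subderivation may resolve on. *)
Definition rank v := #|[set u | connect (@edge G) u v]|.

Lemma rank_edge v w : edge v w -> rank v < rank w.
Proof.
move=> evw; apply: proper_card; apply/properP; split.
  by apply/subsetP=> u; rewrite !inE => cuv; apply: connect_trans cuv (connect1 evw).
by exists w; rewrite !inE ?connect0 // edge_connect_acyclic.
Qed.

Lemma rank_le v : rank v <= #|G|.
Proof. exact: max_card. Qed.

(* [reach S g r]: the vertex [r] reaches [g] by a path avoiding [S], except that
   its endpoint [g] may be in [S]. *)
Definition reach S g r := connect [rel x y | edge x y && (x \notin S)] r g.

(** The queried vertices that still matter for the goal; the clause derived for a state is required
    to contain their blocks. *)
Definition frontier S g : {set G} :=
  [set p in S | (p == g) || [exists r, reach S g r && edge p r]].

Lemma reach_mono S S' g r : S \subset S' -> reach S' g r -> reach S g r.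
Proof.
move=> sSS'; apply: connect_sub => x y /= /andP[exy xS']; apply: connect1.
by rewrite /= exy (contra (subsetP sSS' x) xS').
Qed.

Lemma reach_trans S g h r : reach S g h -> reach S h r -> reach S g r.
Proof. by move=> gh hr; apply: connect_trans hr gh. Qed.

Lemma reach_edge S g r r' : edge r r' -> r \notin S -> reach S g r' -> reach S g r.
Proof. by move=> e rS; apply: connect_trans; apply: connect1; rewrite /= e. Qed.

Lemma reach_connect S g r : reach S g r -> connect (@edge G) r g.
Proof. by apply: connect_sub => x y /= /andP[exy _]; apply: connect1. Qed.

Lemma reach_rank S g r : reach S g r -> rank r <= rank g.
Proof.
move=> /reach_connect cr; apply: subset_leq_card; apply/subsetP=> u.
by rewrite !inE => cu; apply: connect_trans cu cr.
Qed.

Lemma reach_in S g r : reach S g r -> r \in S -> r = g.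
Proof.
by case/connectP=> [[|x p] /=]; [move=> _ ->|case/andP=> /andP[_ /negPf ->]].
Qed.

Lemma reach_first S g r : reach S g r -> r != g ->
  exists r', [/\ edge r r', r \notin S & reach S g r'].
Proof.
case/connectP=> [[|x p] /=]; first by move=> _ ->; rewrite eqxx.
case/andP=> /andP[erx rS] pp E _; exists x; split=> //.
by apply/connectP; exists p.
Qed.

(** Cut the path at its first visit to [w], if there is one. *)
Lemma reach_split S g w r : reach S g r -> reach (w |: S) w r || reach (w |: S) g r.
Proof.
case/connectP=> p; elim: p r => [|x p IH] r /=.
  by move=> _ ->; rewrite [X in _ || X]connect0 orbT.
case/andP=> /andP[erx rS] pp E.
have [->|rw] := eqVneq r w; first by rewrite [X in X || _]connect0.
have rS' : r \notin w |: S by rewrite !inE negb_or rw.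
by case/orP: (IH _ pp E) => /(reach_edge erx rS') ->; rewrite ?orbT.
Qed.

Lemma frontier_sub S g : frontier S g \subset S.
Proof. by apply/subsetP=> p; rewrite inE => /andP[]. Qed.

Lemma frontier_split S g w :
  frontier S g \subset frontier (w |: S) w :|: frontier (w |: S) g.
Proof.
apply/subsetP=> p; rewrite !inE => /andP[-> /orP[->|/existsP[r /andP[rg epr]]]].
  by rewrite !orbT.
rewrite !orbT /=; case/orP: (reach_split w rg) => rr; apply/orP; [left|right];
  by apply/orP; right; apply/existsP; exists r; rewrite rr.
Qed.

Lemma frontier_goal S g : g \in S -> g \in frontier S g.
Proof. by rewrite inE eqxx => ->. Qed.

(** The successor of [w] on a path to [g] still reaches [g] once [w] is queried, since by acyclicity
    it cannot lead back to [w]. *)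
Lemma frontier_split_mem S g w : g \in S -> w \notin S -> reach S g w ->
  w \in frontier (w |: S) g.
Proof.
move=> gS wS wg; have wDg : w != g by apply: contraNneq wS => ->.
have [r [ewr _ rg]] := reach_first wg wDg.
rewrite !inE eqxx /= (negPf wDg) /=; apply/existsP; exists r; rewrite ewr andbT.
case/orP: (reach_split w rg) => // /reach_connect rw.
by have := edge_connect_acyclic ewr; rewrite rw.
Qed.

Lemma reach_below S g w r : reach S g w -> reach (w |: S) w r -> reach S g r.
Proof. by move=> gw /(reach_mono (subsetUr _ _)); apply: reach_trans. Qed.

(** The last edge of a nontrivial path into [g] leaves a predecessor of [g], so no such path avoids
    [S]. *)
Lemma frontier_leaf S g : preds g \subset S -> frontier S g \subset g |: preds g.
Proof.
move=> pS; apply/subsetP=> p; rewrite !inE => /andP[_ /orP[->//|]].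
case/existsP=> r /andP[rg epr]; suff -> : g = r by rewrite epr orbT.
case/connectP: rg => q {epr}; elim: q r => [|x q IH] r /=; first by [].
case/andP=> /andP[erx rS] pq E.
have xg := IH x pq E.
by move: (subsetP pS r); rewrite inE xg erx => /(_ isT); rewrite (negPf rS).
Qed.

End Dag.

(** * Assignments to blocks, and branching on all bits of a block *)

Section Assignments.

Variables (G : pointed_dag) (k : nat).

Local Notation X := (xor_var G k).
Local Notation value := {ffun 'I_k -> bool}.

Implicit Types (S U : {set G}) (g p u v w : G) (a b : value) (f : G -> value).

(* A value [b] of [w] stands for the clause [blk w b] it falsifies: the literal
   signs are opposite to the truth values.  [par b] says that [w] is true, i.e.
   that the block is a clause of the xor-ification of the negated variable. *)
Definition par b : bool := odd #|[set j | ~~ b j]|.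

Definition blk w b : clause X := [set l : lit X | (l.1.1 == w) && (b l.1.2 == l.2)].

(** The largest clause over the blocks of [S] falsified by the assignment [f], in the same sign
    convention as [blk]. *)
Definition cl S f : clause X :=
  [set l : lit X | (l.1.1 \in S) && (f l.1.1 l.1.2 == l.2)].

Definition block_vars S : {set X} := [set x : X | x.1 \in S].

Definition upd f w b : G -> value := fun v => if v == w then b else f v.

(** The sign [s] belongs to the left child, so that either value of a bit can be treated first. *)
Definition node (x : X) (s : bool) (l r : rtree X) : rtree X :=
  Node x ((concl l :\ (x, s)) :|: (concl r :\ (x, ~~ s))) l r.

Lemma node_correct x s (l r : rtree X) : (x, s) \in concl l -> (x, ~~ s) \in concl r ->
  correct_inferences l -> correct_inferences r -> correct_inferences (node x s l r).
Proof.
move=> hl hr cl cr; rewrite /= cl cr !andbT /resolvent.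
by case: s hl hr => /= -> ->; rewrite ?eqxx //= setUC eqxx orbT.
Qed.

Definition setbit b j s : value := [ffun i => if i == j then s else b i].

Section Threaded.

(* The trees under construction are threaded through a state, which records what
   the trees built so far make available; the last argument of [tr] is a cost. *)
Variables (St : Type) (tr : St -> rtree X -> St -> nat -> Prop) (I0 I1 : St -> Prop).

Hypothesis I1W : forall s, I1 s -> I0 s.
Hypothesis tr_node : forall s l s1 c1 r s2 c2 x C,
  tr s l s1 c1 -> tr s1 r s2 c2 -> I1 s2 ->
  exists s3, tr s (Node x C l r) s3 (c1 + c2 + 1) /\ I1 s3.

(* The value [a] comes first in postorder; only its tree may rely on [I0] alone. *)
Lemma split_bits w S U f a (Req : value -> clause X) K :
  w \notin U ->
  (forall b l, l \in Req b -> l.1.1 != w) ->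
  (forall b s, I0 s -> b = a \/ I1 s -> exists T s',
     [/\ correct_inferences T, reg (block_vars (w |: U)) T,
         blk w b :|: Req b \subset concl T & concl T \subset cl S f :|: blk w b]
     /\ tr s T s' K /\ I1 s') ->
  forall s, I0 s -> exists T s',
     [/\ correct_inferences T, reg (block_vars U) T,
         (forall b, Req b \subset concl T) & concl T \subset cl S f]
     /\ tr s T s' (2 ^ k * (K + 1)).-1 /\ I1 s'.
Proof.
move=> wU Reqw job s0 I0s0.
have P js b0 s : uniq js -> I0 s -> I1 s \/ (forall i, i \notin js -> b0 i = a i) ->
  exists T s',
   [/\ correct_inferences T,
       reg (block_vars U :|: [set x : X | (x.1 == w) && (x.2 \notin js)]) T,
       (forall i, i \notin js -> ((w, i), b0 i) \in concl T),
       (forall b, (forall i, i \notin js -> b i = b0 i) -> Req b \subset concl T)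
     & concl T \subset cl S f :|:
         [set l : lit X | [&& l.1.1 == w, l.1.2 \notin js & b0 l.1.2 == l.2]]]
   /\ tr s T s' (2 ^ size js * (K + 1)).-1 /\ I1 s'.
  elim: js b0 s => [|j js IH] b0 s.
    move=> _ I0s I1s; have [||T [s' [[cT rT lT uT] [trT I1s']]]] := job b0 s.
    - by [].
    - by case: I1s => [|E]; [right|left; apply/ffunP=> i; apply: E].
    exists T, s'; rewrite mul1n addn1; split=> //; split=> //.
    - apply: reg_sub rT; apply/subsetP=> x; rewrite !inE orbC.
      by case/orP=> [/andP[->]|->] //; rewrite orbT.
    - by move=> i _; apply: (subsetP lT); rewrite !inE /= !eqxx.
    - move=> b E; have -> : b = b0 by apply/ffunP=> i; apply: E.
      exact: subset_trans (subsetUr _ _) lT.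
  case/andP=> jjs ujs I0s I1s.
  (* The value [a j] goes left; this establishes [I1], which the right half may then rely on. *)
  have [|l [s1 [[okl rl al Rl ul] [trl I1s1]]]] := IH (setbit b0 j (a j)) s ujs I0s.
    case: I1s => [|E]; [by left|right=> i ijs].
    by rewrite ffunE; case: eqP => [->//|/eqP ij]; apply: E; rewrite inE negb_or ij.
  have [r [s2 [[okr rr ar Rr ur] [trr I1s2]]]] :=
    IH (setbit b0 j (~~ a j)) s1 ujs (I1W I1s1) (or_introl I1s1).
  have jl : ((w, j), a j) \in concl l by have := al j jjs; rewrite ffunE eqxx.
  have jr : ((w, j), ~~ a j) \in concl r by have := ar j jjs; rewrite ffunE eqxx.
  have [s3 [tr3 I1s3]] := tr_node (w, j)
    ((concl l :\ ((w, j), a j)) :|: (concl r :\ ((w, j), ~~ a j))) trl trr I1s2.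
  exists (node (w, j) (a j) l r), s3; split; last first.
    (* With [n] leaves of cost [K] there are [n - 1] inferences, hence the cost
       [n * (K + 1) - 1]. *)
    split=> //; move: tr3; congr tr; rewrite /= expnS.
    have : 0 < 2 ^ size js by rewrite expn_gt0.
    by move: (2 ^ _) => n; clear; nia.
  have rsub : (w, j) |: (block_vars U :|: [set x : X | (x.1 == w) && (x.2 \notin j :: js)])
      \subset block_vars U :|: [set x : X | (x.1 == w) && (x.2 \notin js)].
    apply/subsetP=> -[v i]; rewrite !inE /= negb_or xpair_eqE.
    by case/or3P=> [/andP[/eqP-> /eqP->]|->|/and3P[-> _ ->]]; rewrite ?eqxx ?jjs ?orbT.
  split.
  - exact: node_correct.
  - by rewrite /= (reg_sub rsub rl) (reg_sub rsub rr) !inE /= (negPf wU) !eqxx.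
  - move=> i; rewrite inE negb_or => /andP[ij ijs]; rewrite !inE !xpair_eqE (negPf ij) andbF /=.
    by have := al i ijs; rewrite ffunE (negPf ij) => ->.
  - move=> b E; apply/subsetP=> -[[v i] t] vR; have vw := Reqw _ _ vR.
    rewrite !inE !xpair_eqE (negPf vw) /=.
    case: (eqVneq (b j) (a j)) => bj; apply/orP; [left|right].
      apply: (subsetP (Rl b _)) vR => i' i'js; rewrite ffunE.
      by case: eqP => [->//|/eqP ij]; apply: E; rewrite inE negb_or ij.
    apply: (subsetP (Rr b _)) vR => i' i'js; rewrite ffunE.
    case: eqP => [->|/eqP ij]; last by apply: E; rewrite inE negb_or ij.
    by move: bj; case: (b j); case: (a j).
  - apply/subsetP=> -[[v i] t]; rewrite !inE !xpair_eqE /=.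
    have aux c T : concl T \subset cl S f :|:
         [set l : lit X | [&& l.1.1 == w, l.1.2 \notin js & setbit b0 j c l.1.2 == l.2]] ->
       ~~ [&& v == w, i == j & t == c] && ((v, i, t) \in concl T) ->
       (v \in S) && (f v i == t) || [&& v == w, ~~ ((i == j) || (i \in js)) & b0 i == t].
      move=> uT /andP[ne /(subsetP uT)]; rewrite !inE /= => /orP[->//|].
      case/and3P=> vw ijs; rewrite ffunE; move: ne; rewrite vw (negPf ijs) orbF /=.
      case: eqP => [->|_] /=; last by move=> _ ->; rewrite orbT.
      by rewrite eq_sym => /negPf ->.
    rewrite -!andbA; case/orP=> h.
      exact: aux _ _ ul h.
    exact: aux _ _ ur h.
have [|T [s' [[cT rT aT RT uT] [trT I1s']]]] := P (enum 'I_k) a s0 (enum_uniq _) I0s0.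
  by right=> i; rewrite mem_enum.
exists T, s'; rewrite size_enum_ord in trT; split=> //; split=> //.
- by apply: reg_sub rT; apply: subsetUl.
- by move=> b; apply: RT => i; rewrite mem_enum.
- by apply: subset_trans uT _; apply/subsetP=> l; rewrite !inE mem_enum andbF orbF.
Qed.

(** What a search state has to deliver. The lower bound on the conclusion keeps later inferences
    from being degenerate, and the upper bound says that the path falsifies it. [U] collects the
    blocks that [T] must not resolve on, possibly more than [S]. *)
Definition sol S g U f (T : rtree X) : Prop :=
  [/\ correct_inferences T, reg (block_vars U) T,
      cl (frontier S g) f \subset concl T & concl T \subset cl S f].

Lemma par_true_value : par [ffun=> true] = false.
Proof.
by rewrite /par eq_card0 // => j; rewrite !inE ffunE.
Qed.

Lemma par_odd_value (j0 : 'I_k) : par [ffun j => j != j0].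
Proof.
rewrite /par (_ : [set j | _] = [set j0]) ?cards1 //.
by apply/setP=> j; rewrite !inE ffunE negbK.
Qed.

(* The blocks needed by the parent are each needed by one of the two kinds of
   children, and every child needs the block of [w]; so every inference really
   resolves on its variable. *)
Lemma split_vertex w S g U f a K :
  0 < k -> g \in S -> S \subset U -> w \notin U -> reach S g w ->
  (forall b s, I0 s -> b = a \/ I1 s -> exists T s',
     sol (w |: S) (if par b then g else w) (w |: U) (upd f w b) T
     /\ tr s T s' K /\ I1 s') ->
  forall s, I0 s -> exists T s',
     sol S g U f T /\ tr s T s' (2 ^ k * (K + 1)).-1 /\ I1 s'.
Proof.
move=> k0 gS sSU wU gw job s I0s.
have wS : w \notin S by apply: contra wU; apply: (subsetP sSU).
pose Req b := cl (frontier (w |: S) (if par b then g else w) :\ w) f.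
have [b l|b s1 I0s1 I1s1|T [s' [[okT rT RT uT] trT]]] :=
    @split_bits w S U f a Req K wU _ _ s I0s.
- by rewrite !inE => /andP[/andP[]].
- have [T [s' [[okT rT lT uT] trT]]] := job b s1 I0s1 I1s1.
  exists T, s'; split=> //; split=> //.
    rewrite subUset; apply/andP; split; apply: subset_trans _ lT.
      apply/subsetP=> -[[v i] t]; rewrite inE /= => /andP[/eqP-> bt].
      rewrite inE /= /upd eqxx bt andbT.
      by case: (par b); [apply: frontier_split_mem|apply: frontier_goal; rewrite setU11].
    apply/subsetP=> -[[v i] t]; rewrite [in X in _ -> X]inE [in X in X -> _]inE /=.
    by rewrite in_setD1 /upd => /andP[/andP[/negPf-> ->]].
  apply: subset_trans uT _; apply/subsetP=> -[[v i] t]; rewrite !inE /= /upd.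
  case: (eqVneq v w) => [->|_] /=; last by rewrite orbF.
  by move=> ->; rewrite orbT.
exists T, s'; split=> //; split=> //; apply/subsetP=> -[[v i] t].
rewrite inE /= => /andP[vf ft].
have vw : v != w by apply: contraNneq wS => <-; apply: (subsetP (frontier_sub _ _)) vf.
(* A nonempty block has values of both parities, so both kinds of children occur. *)
have /setUP[vF|vF] := subsetP (frontier_split S g w) v vf.
  by apply: (subsetP (RT [ffun=> true])); rewrite inE /= par_true_value in_setD1 vw vF.
apply: (subsetP (RT [ffun j => j != Ordinal k0])).
by rewrite inE /= par_odd_value in_setD1 vw vF.
Qed.

End Threaded.
End Assignments.

(** * Axioms falsified by assignments, lower bounds on the formula size, and removal of guards *)

Section Formula.

Variables (G : pointed_dag) (k : nat).
Hypothesis k_gt0 : 0 < k.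

Local Notation X := (xor_var G k).
Local Notation value := {ffun 'I_k -> bool}.

Implicit Types (S U : {set G}) (g p u v w : G) (a b : value) (f : G -> value).

Definition nbhd w : {set G} := w |: preds w.

Lemma blk_xor_lit v b s : par b = ~~ s -> blk v b \in xor_lit k (v, s).
Proof.
move=> pb; apply/imsetP; exists b; first by rewrite inE -/(par b) pb.
apply/setP=> -[[u i] t]; rewrite inE /=; apply/andP/imsetP => [[/eqP-> /eqP<-]|[j _ [-> -> ->]]].
  by exists i.
by rewrite !eqxx.
Qed.

Lemma blk_sink_xor_Peb b : par b -> blk (sink G) b \in xor_Peb G k.
Proof.
move=> pb; apply/bigcupP; exists [set (sink G, false)]; first by rewrite !inE eqxx orbT.
apply/imsetP; exists [ffun=> blk (sink G) b]; last by rewrite big_set1 ffunE.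
by rewrite inE; apply/forall_inP=> z /set1P->; rewrite ffunE blk_xor_lit // pb.
Qed.

(** This is an instance of axiom ($\alpha$) if [w] is a source and of axiom ($\beta$) otherwise. *)
Lemma cl_nbhd_xor_Peb w f : ~~ par (f w) -> (forall u, u \in preds w -> par (f u)) ->
  cl (nbhd w) f \in xor_Peb G k.
Proof.
move=> pw pu; pose C := (w, true) |: [set (u, false) | u in preds w].
apply/bigcupP; exists C.
  rewrite !inE; apply/orP; left; case: (boolP (is_source w)) => sw; apply/orP; [left|right].
    by apply/imsetP; exists w; rewrite ?inE // /C (eqP sw) imset0 setU0.
  by apply/imsetP; exists w; rewrite ?inE.
apply/imsetP; exists [ffun z : lit G => blk z.1 (f z.1)].
  rewrite inE; apply/forall_inP=> z /setU1P[->|/imsetP[u uw ->]]; rewrite ffunE /=.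
    by rewrite blk_xor_lit // (negPf pw).
  by rewrite blk_xor_lit // pu.
apply/setP=> -[[u i] t]; rewrite inE /=; apply/andP/bigcupP => [[/setU1P uC ft]|[z zC]].
  case: uC => [uw|uw].
    by exists (w, true); rewrite ?setU11 // ffunE inE /= uw eqxx -uw.
  exists (u, false); last by rewrite ffunE inE /= eqxx.
  by apply/setU1P; right; apply/imsetP; exists u.
rewrite ffunE inE /= => /andP[/eqP-> ft]; split=> //.
case/setU1P: zC => [->|/imsetP[v vw ->]]; first exact: setU11.
by rewrite inE vw orbT.
Qed.

Lemma card_preds w : #|preds w| <= 2.
Proof. by have := indegree02 w; rewrite !inE => /orP[] /eqP ->. Qed.

Lemma cl_blk w f : cl [set w] f = blk w (f w).
Proof.
apply/setP=> -[[v i] t]; rewrite !inE /=.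
by case: eqP => [->|].
Qed.

Lemma cl_sub S S' f : S \subset S' -> cl S f \subset cl S' f.
Proof.
move=> sSS'; apply/subsetP=> l; rewrite !inE => /andP[lS ->].
by rewrite (subsetP sSS').
Qed.

Lemma eq_cl S f f' : {in S, f =1 f'} -> cl S f = cl S f'.
Proof.
move=> E; apply/setP=> l; rewrite !inE; case: (boolP (_ \in S)) => //= lS.
by rewrite E.
Qed.

(** Each value of the sink falsifies an axiom containing its whole block: ($\gamma$) if the sink is
    true, its own axiom with true predecessors if not. The axiom determines the value. *)
Lemma card_value_xor_Peb : 2 ^ k <= #|xor_Peb G k|.
Proof.
pose t := sink G.
pose f b := upd (fun=> [ffun j => j != Ordinal k_gt0]) t b.
pose C b := if par b then blk t b else cl (nbhd t) (f b).
have -> : 2 ^ k = #|[set: value]|.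
  by rewrite cardsT card_ffun card_bool card_ord.
rewrite -(@card_in_imset _ _ C); last first.
  have mem b i s : (((t, i), s) \in C b) = (b i == s).
    rewrite /C; case: ifP => _; rewrite inE /= /f /upd eqxx //.
    by rewrite setU11.
  move=> b b' _ _ E; apply/ffunP=> i; apply/eqP.
  by rewrite -mem E mem.
apply/subset_leq_card/subsetP=> _ /imsetP[b _ ->]; rewrite /C.
case: ifPn => pb; first exact: blk_sink_xor_Peb.
apply: cl_nbhd_xor_Peb; rewrite /f /upd ?eqxx // => u.
rewrite inE; case: eqP => [->|_ _]; first by rewrite edge_irrefl.
exact: par_odd_value.
Qed.

(** In the axiom chosen for [w], only [w] has a value whose first bit is true, so the axiom
    determines [w]. *)
Lemma card_vertex_xor_Peb : #|G| <= #|xor_Peb G k|.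
Proof.
pose f w := upd (fun=> [ffun j => j != Ordinal k_gt0]) w [ffun=> true].
pose C w := cl (nbhd w) (f w).
rewrite -cardsT -(@card_in_imset _ _ C); last first.
  move=> w w' _ _ E; have : ((w, Ordinal k_gt0), true) \in C w.
    by rewrite inE /= setU11 /f /upd eqxx ffunE.
  rewrite E inE /= /f /upd => /andP[_].
  by case: (eqVneq w w') => // _; rewrite ffunE eqxx.
apply/subset_leq_card/subsetP=> _ /imsetP[w _ ->].
apply: cl_nbhd_xor_Peb; rewrite /f /upd ?eqxx ?par_true_value // => u.
rewrite inE; case: eqP => [->|_ _]; first by rewrite edge_irrefl.
exact: par_odd_value.
Qed.

Section Guard.

Variable rho : clause X -> X.
Hypothesis guard : guard_function rho.

(** Different [C] may yield the same guarded clause, but the clause together with its guard literal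
    determines [C]; so literal occurrences are counted. *)
Lemma card_xor_Peb_GPeb : #|xor_Peb G k| <= cnf_size (GPeb rho).
Proof.
pose P := [set q : clause X * lit X | (q.1 \in GPeb rho) && (q.2 \in q.1)].
have -> : cnf_size (GPeb rho) = #|P|.
  rewrite /cnf_size -sum1_card (partition_big fst (mem (GPeb rho))) /=; last first.
    by move=> q; rewrite inE => /andP[].
  apply: eq_bigr => D DF; rewrite sum1dep_card.
  rewrite -(card_imset D (f := pair D)); last by move=> x y [].
  apply: eq_card => -[D' l]; rewrite [in RHS]inE [(D', l) \in P]inE /=; apply/imsetP/idP.
    by case=> l' l'D [-> ->]; rewrite DF l'D eqxx.
  by case/andP=> /andP[_ lD] /eqP E; exists l; rewrite -E.
pose h C := ((rho C, true) |: C, (rho C, true)) : clause X * lit X.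
have hP : {in xor_Peb G k &, injective h}.
  move=> C C' CF C'F [E1 E2].
  rewrite -(setU1K (guard CF true)) -(setU1K (guard C'F true)).
  by rewrite E1 E2.
rewrite -(card_in_imset hP); apply/subset_leq_card/subsetP=> _ /imsetP[C CF ->].
rewrite inE /= setU11 andbT inE; apply/orP; left.
by apply/imsetP; exists C.
Qed.

Lemma guard_var U f : cl U f \in xor_Peb G k -> (rho (cl U f)).1 \notin U.
Proof.
move=> CF; apply/negP=> rU; case/negP: (guard CF (f (rho (cl U f)).1 (rho (cl U f)).2)).
by rewrite [_ \in cl _ _]inE /= rU eqxx.
Qed.

Lemma guarded_mem C s : C \in xor_Peb G k -> (rho C, s) |: C \in GPeb rho.
Proof.
by move=> CF; rewrite inE; case: s; apply/orP; [left|right]; apply/imsetP; exists C.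
Qed.

(** A single inference between two axioms, hence an input derivation that turns [C] into a lemma. *)
Definition unguard C : rtree X :=
  node (rho C) true (Leaf ((rho C, true) |: C)) (Leaf ((rho C, false) |: C)).

Lemma concl_unguard C : C \in xor_Peb G k -> concl (unguard C) = C.
Proof.
by move=> CF; rewrite /= !setU1K ?setUid ?guard.
Qed.

Lemma unguard_correct C : correct_inferences (unguard C).
Proof. by apply: node_correct => //=; rewrite setU11. Qed.

Lemma unguard_valid L C : C \in xor_Peb G k -> valid (GPeb rho) L (unguard C).
Proof. by move=> CF; rewrite /= [X in X && _]in_setU [X in _ && X]in_setU !guarded_mem. Qed.

Lemma unguard_lemma C : C \in xor_Peb G k -> C \in lemmas (unguard C).
Proof. by move=> CF; rewrite -{1}(concl_unguard CF) lemmas_root. Qed.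

End Guard.
End Formula.

(** * The standard refutation of a state whose relevant clauses are all usable *)

Section Refutation.

Variables (G : pointed_dag) (k : nat) (rho : clause (xor_var G k) -> xor_var G k).
Hypotheses (k_gt0 : 0 < k) (guard : guard_function rho).

Local Notation X := (xor_var G k).
Local Notation value := {ffun 'I_k -> bool}.
Local Notation F := (GPeb rho).

Implicit Types (S U : {set G}) (g p u v w : G) (a b : value) (f : G -> value).

Section Standard.

Variables (L : {set clause X}) (S0 : {set G}) (g0 : G) (f0 : G -> value).

Hypothesis usable : forall w f, reach S0 g0 w -> {in S0, f =1 f0} ->
  ~~ par (f w) -> (forall u, u \in preds w -> par (f u)) ->
  cl (nbhd w) f \in L \/ (rho (cl (nbhd w) f)).1 \in S0.

Lemma usable_leaf w f : reach S0 g0 w -> {in S0, f =1 f0} ->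
  ~~ par (f w) -> (forall u, u \in preds w -> par (f u)) ->
  exists2 D, D \in F :|: L
    & cl (nbhd w) f \subset D /\ D \subset cl (nbhd w) f :|: cl S0 f0.
Proof.
move=> wg ff0 pw pu; have CF := cl_nbhd_xor_Peb pw pu.
have [CL|rS] := usable wg ff0 pw pu.
  by exists (cl (nbhd w) f); [rewrite inE CL orbT|rewrite subsetUl].
set C := cl _ _ in CF rS *; set x := rho C in rS.
(* Of the two guarded versions, take the one whose guard literal is falsified by [f0]. *)
exists ((x, f0 x.1 x.2) |: C); first by rewrite in_setU guarded_mem.
split; first exact: subsetUr.
rewrite setUC setUS // sub1set inE /=; apply/andP; split=> //.
Qed.

(** A derivation with goal [v] resolves only on blocks of rank below that of [v], which allows it to
    be placed below queries of larger rank. *)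
Definition up v : {set G} := [set u | rank v <= rank u].

Definition good (ts : seq (rtree X)) :=
  subtree_closed ts /\ all (leaves_in (F :|: L)) ts.

(* [ts] collects the distinct subtrees of the refutation, which as a tree may be
   exponentially large. *)
Definition collect (ts : seq (rtree X)) T (ts' : seq (rtree X)) c :=
  [/\ T \in ts', {subset ts <= ts'} & size ts' <= size ts + c].

Lemma good_node ts x C l r : good ts -> l \in ts -> r \in ts ->
  good (Node x C l r :: ts).
Proof.
move=> [cl al] lts rts; split.
  move=> y D l' r'; rewrite inE => /orP[/eqP[_ _ -> ->]|/cl/andP[h1 h2]].
    by rewrite !inE lts rts !orbT.
  by rewrite !inE h1 h2 !orbT.
by rewrite /= al (allP al _ lts) (allP al _ rts).
Qed.

Definition extends (ts0 ts : seq (rtree X)) := good ts /\ {subset ts0 <= ts}.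

Lemma collect_node ts0 ts l ts1 c1 r ts2 c2 x C :
  collect ts l ts1 c1 -> collect ts1 r ts2 c2 -> extends ts0 ts2 ->
  exists ts3, collect ts (Node x C l r) ts3 (c1 + c2 + 1) /\ extends ts0 ts3.
Proof.
move=> [l1 s1 n1] [r2 s2 n2] [g2 e2]; exists (Node x C l r :: ts2).
have s02 : {subset ts0 <= Node x C l r :: ts2} by move=> t /e2 h; rewrite inE h orbT.
split; last by split=> //; apply: good_node => //; apply: s2.
split; first by rewrite inE eqxx.
  by move=> t /s1/s2 h; rewrite inE h orbT.
by rewrite /=; move: n1 n2; clear; lia.
Qed.

Lemma collectW ts T ts' c c' : c <= c' -> collect ts T ts' c -> collect ts T ts' c'.
Proof. by move=> cc' [? ? n]; split=> //; apply: leq_trans n _; rewrite leq_add2l. Qed.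

(** These derivations do not depend on what was queried between [S0] and [v], so all parents of [v]
    share them. *)
Definition known (ts : seq (rtree X)) v := forall b, ~~ par b ->
  exists2 T, T \in ts & sol (v |: S0) v (v |: S0 :|: up v) (upd f0 v b) T.

(** Cost of branching on [i] blocks in turn when every final state costs [e]. *)
Fixpoint ecost e i := if i is j.+1 then 2 ^ k * (ecost e j + 1) else e.

Lemma expand_leaf ts0 v S f c : preds v \subset S -> 0 < c ->
  v \in S -> S0 \subset S -> {in S0, f =1 f0} -> ~~ par (f v) ->
  (forall u, u \in preds v :&: S -> par (f u)) -> reach S0 g0 v ->
  forall ts, extends ts0 ts -> exists T ts',
    sol S v (S :|: up v) f T /\ collect ts T ts' c /\ extends ts0 ts'.
Proof.
move=> pS c0 vS sS ff0 pv pu vg ts [[cls als] e].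
have pu' u : u \in preds v -> par (f u).
  by move=> uv; apply: pu; rewrite inE uv (subsetP pS).
have [D DF [D1 D2]] := usable_leaf vg ff0 pv pu'.
exists (Leaf D), (Leaf D :: ts); split.
  split=> //.
    by apply: subset_trans D1; apply: cl_sub; apply: frontier_leaf.
  apply: subset_trans D2 _; rewrite subUset -(eq_cl ff0) !cl_sub //.
  by rewrite subUset sub1set vS.
have sub t : t \in ts -> t \in Leaf D :: ts by rewrite inE => ->; rewrite orbT.
split; first by split; rewrite ?mem_head //= -addn1 leq_add2l.
split; last by move=> t /e/sub.
split; last by rewrite /= DF.
by move=> y E l r; rewrite inE => /= /cls/andP[/sub -> /sub ->].
Qed.

(** The remaining predecessors are queried by decreasing rank. A false one is closed by its shared
    derivation; when all are true, the axiom at [v] is a leaf. *)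
Lemma expand ts0 i v S f : #|preds v :\: S| <= i ->
  v \in S -> S0 \subset S -> {in S0, f =1 f0} -> ~~ par (f v) ->
  (forall u, u \in preds v :&: S -> par (f u)) -> reach S0 g0 v ->
  (forall x p, x \in S -> x \notin S0 -> p \in preds v :\: S -> rank p <= rank x) ->
  (forall p, p \in preds v :\: S -> known ts0 p) ->
  forall ts, extends ts0 ts -> exists T ts',
    sol S v (S :|: up v) f T /\ collect ts T ts' (ecost 1 i) /\ extends ts0 ts'.
Proof.
elim: i S f => [|i IH] S f ci vS sS ff0 pv pu vg rk kn ts ets.
  apply: expand_leaf ets => //.
  by rewrite -setD_eq0 -cards_eq0 -leqn0.
have [D0|[p0 p0v]] := set_0Vmem (preds v :\: S).
  apply: expand_leaf ets => //; first by rewrite -setD_eq0 D0.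
  by rewrite /= muln_gt0 expn_gt0 addn1.
have [p pvS0 pmax] := arg_maxnP (fun u => rank u) p0v.
have pvS : p \in preds v :\: S := pvS0.
have [pS epv] : p \notin S /\ edge p v by move: pvS; rewrite !inE => /andP[].
have pS0 : p \notin S0 by apply: contra pS; apply: (subsetP sS).
have vp : (v == p) = false by apply: contraNF pS => /eqP <-.
have [||||b ts1 ets1 _|T [ts' [sT [cT eT]]]] := @split_vertex G k _ collect (extends ts0)
  (extends ts0) _ (@collect_node ts0) p S v (S :|: up v) f [ffun=> true] (ecost 1 i)
  k_gt0 vS _ _ _ _ ts ets.
- by [].
- exact: subsetUl.
- by rewrite !inE negb_or pS -ltnNge rank_edge.
- by apply: reach_edge epv pS _; apply: connect0.
- rewrite setUA; case: ifPn => pb.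
    apply: IH => //.
    + by rewrite setUC -setDDl (cardsD1 p) pvS in ci *.
    + by rewrite in_setU vS orbT.
    + by apply: subset_trans sS (subsetUr _ _).
    + by move=> x xS0; rewrite /upd; case: eqP xS0 => [->|_ /ff0//]; rewrite (negPf pS0).
    + by rewrite /upd vp.
    + move=> u; rewrite !inE /upd => /andP[uv]; case: eqP => //= _ uS.
      by apply: pu; rewrite !inE uv.
    + move=> x q; rewrite in_setU1 => xS xS0; rewrite setUC -setDDl => /setD1P[_ qv].
      by case/orP: xS => [/eqP->|xS]; [apply: pmax|apply: rk].
    + by move=> q; rewrite setUC -setDDl => /setD1P[_ qv]; apply: kn.
  have [T Tts [okT rT lT uT]] := kn p pvS b pb.
  have [gts sts] := ets1.
  exists T, ts1; split; last first.
    by split=> //; split=> //; rewrite ?leq_addr //; apply: sts.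
  have eqf : {in p |: S0, upd f p b =1 upd f0 p b}.
    move=> x; rewrite in_setU1 /upd; case: eqP => //= _; exact: ff0.
  split=> //.
  (* Blocks queried since [S0], and those of [up v], have rank at least that of [p], so the shared
     derivation leaves them alone. *)
  + apply: reg_sub rT; apply/subsetP=> -[x j]; rewrite !inE /=.
    case/orP=> [/orP[->//|xS]|xv]; last first.
      by rewrite (leq_trans (ltnW (rank_edge epv)) xv) orbT.
    case: (boolP (x \in S0)) => [|xS0]; rewrite ?orbT //=.
    by rewrite (rk x p) ?orbT.
  (* A vertex with an edge to something reaching [p] has rank below that of [p], so those queried
     since [S0], other than [p], are not in the frontier. *)
  + have sfr : frontier (p |: S) p \subset frontier (p |: S0) p.
      apply/subsetP=> x; rewrite !inE => /andP[xpS /orP[->//|/existsP[r /andP[rp exr]]]].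
      apply/andP; split; last first.
        apply/orP; right; apply/existsP; exists r; rewrite exr andbT.
        by apply: reach_mono rp; rewrite setUS.
      case/orP: xpS => [->//|xS]; case: (boolP (x \in S0)) => [|xS0]; rewrite ?orbT //.
      have := leq_trans (rank_edge exr) (reach_rank rp).
      by rewrite ltnNge (rk x p).
    apply: subset_trans lT; rewrite (eq_cl (f' := upd f0 p b)) ?cl_sub // => x.
    by move=> /(subsetP sfr)/(subsetP (frontier_sub _ _)); apply: eqf.
  + apply: subset_trans uT _; rewrite -(eq_cl eqf); apply: cl_sub.
    by rewrite setUS.
exists T, ts'; split=> //; split=> //; apply: collectW cT.
by rewrite /= leq_pred.
Qed.

Hypothesis frontier_true : forall p r, p \in S0 -> edge p r -> reach S0 g0 r -> par (f0 p).

(** Induction on the rank. Each stage runs through all pairs of a vertex and a value and adds at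
    most [ecost 1 2] trees per pair, as there are at most two predecessors. *)
Lemma known_below n : exists ts, [/\ good ts,
    size ts <= n * (#|G| * 2 ^ k * ecost 1 2)
  & forall v, rank v < n -> v \notin S0 -> reach S0 g0 v -> known ts v].
Proof.
elim: n => [|n [ts [gts sz kn]]]; first by exists [::]; split.
have [ts' [[gts' ets'] sz' kn']] : exists ts', [/\ extends ts ts',
    size ts' <= size ts + size (enum {: G * value}) * ecost 1 2
  & forall v b, (v, b) \in enum {: G * value} -> rank v <= n -> v \notin S0 ->
      reach S0 g0 v -> ~~ par b ->
      exists2 T, T \in ts' & sol (v |: S0) v (v |: S0 :|: up v) (upd f0 v b) T].
  elim: (enum _) => [|[v b] ps [ts1 [ets1 sz1 kn1]]].
    by exists ts; split; [split|exact: leq_addr|].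
  case: (boolP [&& rank v <= n, v \notin S0, reach S0 g0 v & ~~ par b]); last first.
    move=> ncond; exists ts1; split=> //.
      by apply: leq_trans sz1 _; rewrite leq_add2l leq_mul.
    move=> v' b'; rewrite inE => /orP[/eqP[-> ->] h1 h2 h3 h4|]; last exact: kn1.
    by rewrite h1 h2 h3 h4 in ncond.
  case/and4P=> vn vS0 vg pb.
  have below p : p \in preds v :\: (v |: S0) -> [/\ edge p v, p != v & p \notin S0].
    by rewrite !inE negb_or => /andP[/andP[-> ->] ->].
  have [||||||x p|p|T [ts2 [sT [[Tts2 s12 sz2] ets2]]]] :=
    @expand ts 2 v (v |: S0) (upd f0 v b) _ _ _ _ _ _ vg _ _ ts1 ets1.
  - by apply: leq_trans (card_preds v); apply/subset_leq_card/subsetDl.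
  - exact: setU11.
  - exact: subsetUr.
  - by move=> x xS0; rewrite /upd; case: eqP xS0 => [->|//]; rewrite (negPf vS0).
  - by rewrite /upd eqxx.
  - move=> u; rewrite !inE /upd => /andP[uv].
    case: eqP uv => [->|_ uv /= uS0]; first by rewrite edge_irrefl.
    exact: frontier_true uS0 uv vg.
  - by rewrite in_setU1 => /orP[/eqP->|->//] _ /below[/rank_edge/ltnW].
  - case/below=> epv _ pS0; apply: kn => //; first exact: leq_trans (rank_edge epv) vn.
    exact: reach_edge vg.
  exists ts2; split=> //.
    by apply: leq_trans sz2 _; rewrite -[size (_ :: _)]/(size ps).+1 mulSn addnCA addnC leq_add2l.
  move=> v' b'; rewrite inE => /orP[/eqP[-> ->] _ _ _ _|h h1 h2 h3 h4]; first by exists T.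
  by have [T' /s12 T'ts sT'] := kn1 v' b' h h1 h2 h3 h4; exists T'.
exists ts'; split=> //.
  apply: leq_trans sz' _; rewrite -cardE card_prod card_ffun card_bool card_ord mulSn addnC.
  by rewrite leq_add2l.
by move=> v vn vS0 vg b pb; apply: kn' => //; rewrite mem_enum.
Qed.

(** The bound of [input_lemma_compression] for the trees of [known_below] up to the maximal rank,
    plus one expansion of the goal. *)
Definition standard_size : nat :=
  1 + 2 * ((#|G|.+1 * (#|G| * 2 ^ k * ecost 1 2) + ecost 1 2) * (#|G| * k)).

Lemma standard_refutation : g0 \in S0 -> ~~ par (f0 g0) -> exists T,
  [/\ sol S0 g0 S0 f0 T, valid F L T & num_clauses T <= standard_size].
Proof.
move=> gS0 pg; have [ts [gts sz kn]] := known_below #|G|.+1.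
have [||||||||T [ts' [[okT rT lT uT] [[Tts' _ sz'] [[cl al] _]]]]] :=
  @expand ts 2 g0 S0 f0 _ gS0 _ _ pg _ _ _ _ ts.
- by apply: leq_trans (card_preds g0); apply/subset_leq_card/subsetDl.
- by [].
- by [].
- move=> u; rewrite !inE => /andP[ug uS0].
  by apply: frontier_true uS0 ug _; apply: connect0.
- exact: connect0.
- by move=> x p ->.
- move=> p; rewrite !inE => /andP[pS0 epg]; apply: kn => //.
    by rewrite ltnS rank_le.
  by apply: reach_edge epg pS0 _; apply: connect0.
- by split.
have rT0 : reg (block_vars k S0) T.
  by apply: reg_sub rT; apply/subsetP=> x; rewrite !inE => ->.
have [T' [cT' okT' rT' vT' nT']] :=
  input_lemma_compression cl Tts' okT rT0 (allP al _ Tts').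
exists T'; split=> //; first by split=> //; rewrite cT'.
apply: leq_trans nT' _; rewrite card_prod card_ord leq_add2l leq_mul // leq_mul //.
by apply: leq_trans sz' _; rewrite leq_add2r.
Qed.

End Standard.
End Refutation.

(** * Amortized search: learning unusable clauses *)

Section Learning.

Variables (G : pointed_dag) (k : nat) (rho : clause (xor_var G k) -> xor_var G k).
Hypotheses (k_gt0 : 0 < k) (guard : guard_function rho).

Local Notation X := (xor_var G k).
Local Notation value := {ffun 'I_k -> bool}.
Local Notation F := (GPeb rho).
Local Notation ecost := (ecost k).
Local Notation standard_size := (standard_size G k).

Implicit Types (S U : {set G}) (g p u v w : G) (a b : value) (f : G -> value).
Implicit Types (L P : {set clause X}).

Lemma ecost_ge e i : e <= ecost e i.
Proof.
elim: i => //= i IH; apply: leq_trans IH (leq_trans (leq_addr 1 _) _).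
by rewrite leq_pmull ?expn_gt0.
Qed.

Lemma ecostS e i : ecost e i <= ecost e i.+1.
Proof. by rewrite /= (leq_trans (leq_addr 1 _)) // leq_pmull ?expn_gt0. Qed.

Definition open_state S g f : Prop :=
  [/\ g \in S, ~~ par (f g)
    & forall p r, p \in S -> edge p r -> reach S g r -> par (f p)].

(** If [w] is true it satisfies the condition; if [w] is false it becomes the goal, and by
    acyclicity has no edge into the part below itself. *)
Lemma open_state_split S g f w b : open_state S g f -> reach S g w -> w \notin S ->
  open_state (w |: S) (if par b then g else w) (upd f w b).
Proof.
move=> [gS pg fr] wg wS; have gw : (g == w) = false by apply: contraNF wS => /eqP <-.
case: ifPn => pb; split; rewrite ?setU11 ?in_setU1 ?gS ?orbT // /upd ?gw ?eqxx //.
  move=> p r; rewrite in_setU1; case: eqP => //= _ pS epr rg.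
  by apply: fr pS epr (reach_mono (subsetUr _ _) rg).
move=> p r; rewrite in_setU1; case: eqP => /= [-> _ ewr /reach_connect rw|_ pS epr rw].
  by have := edge_connect_acyclic ewr; rewrite rw.
exact: fr pS epr (reach_below wg rw).
Qed.

(* The price, in tree size, of a clause of [P] that is not yet an input lemma. *)
Definition price : nat := ecost (standard_size + 3) 3.

(** Amortized cost: beyond [c], the tree may spend [price] for each clause of [P] that becomes a
    lemma. *)
Definition learns P L (T : rtree X) L' c : Prop :=
  [/\ valid F L T, L' = L :|: lemmas T
    & num_clauses T + price * #|P :\: L'| <= c + price * #|P :\: L|].

Lemma learnsW P L T L' c c' : c <= c' -> learns P L T L' c -> learns P L T L' c'.
Proof. by move=> cc' [v e n]; split=> //; apply: leq_trans n _; rewrite leq_add2r. Qed.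

Lemma setD_mono P L L' : L \subset L' -> #|P :\: L'| <= #|P :\: L|.
Proof. by move=> s; apply: subset_leq_card; apply: setDS. Qed.

Lemma learns_node P (I : {set clause X} -> Prop) :
  (forall L L', L \subset L' -> I L -> I L') ->
  forall L l L1 c1 r L2 c2 x C,
  learns P L l L1 c1 -> learns P L1 r L2 c2 -> I L2 ->
  exists L3, learns P L (Node x C l r) L3 (c1 + c2 + 1) /\ I L3.
Proof.
move=> Imono L l L1 c1 r L2 c2 x C [vl E1 n1] [vr E2 n2] IL2.
have s23 : L2 \subset L :|: lemmas (Node x C l r).
  by rewrite lemmas_node E2 E1 !setUA subsetUl.
exists (L :|: lemmas (Node x C l r)); split; last exact: Imono IL2.
split=> //; first by rewrite /= vl -E1.
have n3 : price * #|P :\: (L :|: lemmas (Node x C l r))| <= price * #|P :\: L2|.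
  by rewrite leq_mul2l setD_mono ?orbT.
rewrite num_node; move: n1 n2 n3.
move: (price * _) (price * _) (price * _) (price * _) => n3 n2 n1 n0.
by move: (num_clauses l) (num_clauses r) => nl nr; clear; lia.
Qed.

Section Gadget.

Variables (L0 : {set clause X}) (w : G) (f1 : G -> value).

Let C := cl (nbhd w) f1.
(** The price of [C] is set aside to pay for the tree in which [C] is learned. *)
Let P := xor_Peb G k :\ C.

Hypotheses (w_false : ~~ par (f1 w)) (preds_true : forall u, u \in preds w -> par (f1 u)).

(** Supplied by the induction in [close_state], since fewer clauses remain to be learned once [C] is
    a lemma. *)
Hypothesis close_rest : forall L S g f, L0 \subset L -> C \in L -> open_state S g f ->
  exists T L', sol S g S f T /\ learns P L T L' standard_size.

Let I1 L := L0 \subset L /\ C \in L.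

Lemma I1_mono L L' : L \subset L' -> I1 L -> I1 L'.
Proof. by move=> s [h1 h2]; split; [apply: subset_trans s|apply: (subsetP s)]. Qed.

Lemma close_other L S g f i : I1 L -> open_state S g f ->
  exists T L', sol S g S f T /\ learns P L T L' (ecost (standard_size + 3) i) /\ I1 L'.
Proof.
move=> IL os; have [T [L' [sT lT]]] := close_rest IL.1 IL.2 os.
exists T, L'; split=> //; split.
  by apply: learnsW lT; apply: leq_trans (ecost_ge _ _); apply: leq_addr.
by case: lT => _ -> _; apply: I1_mono IL; apply: subsetUl.
Qed.

(** The guard of [C] has not been queried, so resolving on it is still regular. The three nodes of
    [unguard] are the [3] in the cost. *)
Lemma learn_leaf L S f i : preds w \subset S -> open_state S w f ->
  {in nbhd w, f =1 f1} -> (rho C).1 \notin S -> L0 \subset L ->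
  exists T L', sol S w S f T /\ learns P L T L' (ecost (standard_size + 3) i) /\ I1 L'.
Proof.
move=> pS [wS pw fr] ff1 rS sL; have CF := cl_nbhd_xor_Peb w_false preds_true.
exists (unguard rho C), (L :|: lemmas (unguard rho C)); split.
  split; rewrite ?(concl_unguard guard CF).
  - exact: unguard_correct.
  - by rewrite /= inE rS.
  - by rewrite /C -(eq_cl ff1); apply: cl_sub; apply: frontier_leaf.
  - by rewrite /C -(eq_cl ff1); apply: cl_sub; rewrite subUset sub1set wS.
split; last first.
  by split; [apply: subset_trans sL (subsetUl _ _)|rewrite inE unguard_lemma ?orbT].
split=> //; first exact: unguard_valid.
apply: leq_add; last by rewrite leq_mul2l setD_mono ?orbT // subsetUl.
by apply: leq_trans (ecost_ge _ _); apply: leq_addl.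
Qed.

(** The value [f1 p] comes first and its subtree learns [C]; all other values come later in
    postorder and are closed with [C] available. *)
Lemma learn_at L S f i : #|preds w :\: S| <= i -> open_state S w f ->
  (forall u, u \in nbhd w -> u \in S -> f u = f1 u) -> (rho C).1 \notin S -> L0 \subset L ->
  exists T L', sol S w S f T /\ learns P L T L' (ecost (standard_size + 3) i) /\ I1 L'.
Proof.
elim: i L S f => [|i IH] L S f ci os ff1 rS sL.
  have pS : preds w \subset S by rewrite -setD_eq0 -cards_eq0 -leqn0.
  apply: learn_leaf => // u uw; apply: ff1 => //.
  by case/setU1P: uw => [->|/(subsetP pS)//]; case: os.
have [D0|[p pvS]] := set_0Vmem (preds w :\: S).
  have pS : preds w \subset S by rewrite -setD_eq0 D0.
  apply: learn_leaf => // u uw; apply: ff1 => //.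
  by case/setU1P: uw => [->|/(subsetP pS)//]; case: os.
have [pS pw] : p \notin S /\ p \in preds w by apply/andP; rewrite -in_setD.
have wS : w \in S by case: os.
have epw : edge p w by rewrite inE in pw.
have pg : reach S w p by apply: reach_edge epw pS _; apply: connect0.
have job b L1 : L0 \subset L1 -> b = f1 p \/ I1 L1 -> exists T L',
    sol (p |: S) (if par b then w else p) (p |: S) (upd f p b) T
    /\ learns P L1 T L' (ecost (standard_size + 3) i) /\ I1 L'.
  move=> sL1 h; have os' := open_state_split b os pg pS.
  have [bp|bp] := eqVneq b (f1 p); last first.
    by apply: close_other => //; case: h bp => // ->; rewrite eqxx.
  have pb : par b by rewrite bp preds_true.
  rewrite pb in os' *; apply: IH => //.
  - by rewrite setUC -setDDl (cardsD1 p) pvS in ci *.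
  - move=> u uw; rewrite in_setU1 /upd; case: eqP => [-> _|_ /= uS] //; exact: ff1.
  - rewrite in_setU1 negb_or rS andbT.
    (* [C] contains the whole block of [p], so its guard lies in another block. *)
    apply: contraNneq (guard_var guard (cl_nbhd_xor_Peb w_false preds_true)).
    by move=> ->; rewrite in_setU1 pw orbT.
have [T [L' [sT [lT IL']]]] := @split_vertex G k _ (learns P) (fun L => L0 \subset L) I1
  (fun L h => h.1) (learns_node I1_mono) p S w S f (f1 p) _ k_gt0 wS (subxx S) pS pg job L sL.
by exists T, L'; split=> //; split=> //; apply: learnsW lT; apply: leq_pred.
Qed.

Lemma learn_clause S g f : open_state S g f -> reach S g w -> {in S, f1 =1 f} ->
  (rho C).1 \notin S ->
  exists T L', sol S g S f T /\ learns P L0 T L' price /\ I1 L'.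
Proof.
move=> os wg f1f rS; have [wE|wDg] := eqVneq w g.
  have [|||||T [L' [sT [lT IL']]]] := @learn_at L0 S f 2.
  - by apply: leq_trans (card_preds w); apply/subset_leq_card/subsetDl.
  - by rewrite wE.
  - by move=> u _ /f1f.
  - by [].
  - exact: subxx.
  exists T, L'; rewrite -wE; split=> //; split=> //.
  by apply: learnsW lT; apply: ecostS.
have wS : w \notin S by apply: contra wDg => /(reach_in wg) ->.
have gS : g \in S by case: os.
have job b L1 : L0 \subset L1 -> b = f1 w \/ I1 L1 -> exists T L',
    sol (w |: S) (if par b then g else w) (w |: S) (upd f w b) T
    /\ learns P L1 T L' (ecost (standard_size + 3) 2) /\ I1 L'.
  move=> sL1 h; have os' := open_state_split b os wg wS.
  have [bw|bw] := eqVneq b (f1 w); last first.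
    by apply: close_other => //; case: h bw => // ->; rewrite eqxx.
  have pb : par b = false by rewrite bw (negPf w_false).
  rewrite pb in os' *; apply: learn_at => //.
  - by apply: leq_trans (card_preds w); apply/subset_leq_card/subsetDl.
  - move=> u uw; rewrite in_setU1 /upd; case: eqP => [-> _|_ /= /f1f] //.
  - rewrite in_setU1 negb_or rS andbT.
    apply: contraNneq (guard_var guard (cl_nbhd_xor_Peb w_false preds_true)).
    by move=> ->; rewrite setU11.
have [T [L' [sT [lT IL']]]] := @split_vertex G k _ (learns P) (fun L => L0 \subset L) I1
  (fun L h => h.1) (learns_node I1_mono) w S g S f (f1 w) _
  k_gt0 gS (subxx S) wS wg job L0 (subxx _).
by exists T, L'; split=> //; split=> //; apply: learnsW lT; apply: leq_pred.
Qed.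

End Gadget.

(** Induction on the number of clauses that are not yet lemmas: either all relevant clauses are
    usable, or learning a [bad] one lowers this number. *)
Lemma close_state L S g f : open_state S g f ->
  exists T L', sol S g S f T /\ learns (xor_Peb G k) L T L' standard_size.
Proof.
have [m] := ubnP #|xor_Peb G k :\: L|; elim: m L S g f => [//|m IH] L S g f cm os.
pose bad w (f1 : {ffun G -> value}) := [&& reach S g w, [forall x in S, f1 x == f x],
  ~~ par (f1 w), [forall u in preds w, par (f1 u)],
  cl (nbhd w) f1 \notin L & (rho (cl (nbhd w) f1)).1 \notin S].
case: (boolP [exists w, exists f1, bad w f1]) => [|nbad]; last first.
  have [gS pg fr] := os.
  have [w f1 wg f1f pw pu|T [sT vT nT]] := @standard_refutation G k rho k_gt0 L S g f _ fr gS pg.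
    apply/orP; apply: contraR nbad; rewrite negb_or => /andP[nL nS].
    have E : cl (nbhd w) [ffun x => f1 x] = cl (nbhd w) f1.
      by apply: eq_cl => x _; rewrite ffunE.
    apply/existsP; exists w; apply/existsP; exists [ffun x => f1 x].
    rewrite /bad E wg nL nS ffunE pw !andbT /=; apply/andP; split.
      by apply/forall_inP=> x xS; rewrite ffunE f1f.
    by apply/forall_inP=> u uw; rewrite ffunE pu.
  exists T, (L :|: lemmas T); split=> //; split=> //.
  by apply: leq_add => //; rewrite leq_mul2l setD_mono ?orbT // subsetUl.
case/existsP=> w /existsP[f1 /and5P[wg /forall_inP f1f pw /forall_inP pu /andP[nL nS]]].
set C := cl (nbhd w) f1 in nL nS.
have CF : C \in xor_Peb G k by apply: cl_nbhd_xor_Peb.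
have cardC L1 : C \in L1 -> #|xor_Peb G k :\ C :\: L1| = #|xor_Peb G k :\: L1|.
  move=> CL1; apply: eq_card => D; rewrite !inE; case: eqP => [->|] //=.
  by rewrite CL1 andbF.
have CL : C \in xor_Peb G k :\: L by rewrite inE nL.
have cardL : #|xor_Peb G k :\: L| = #|xor_Peb G k :\ C :\: L|.+1.
  by rewrite (cardsD1 C) CL; congr _.+1; apply: eq_card => D; rewrite !inE andbCA.
have close_rest L1 S1 g1 f2 : L \subset L1 -> C \in L1 -> open_state S1 g1 f2 ->
    exists T L', sol S1 g1 S1 f2 T /\ learns (xor_Peb G k :\ C) L1 T L' standard_size.
  move=> sL CL1 os1; have [|T [L' [sT [vT E nT]]]] := IH L1 S1 g1 f2 _ os1.
    apply: leq_trans _ (cm : _ <= m); rewrite (cardsD1 C (_ :\: L)) CL ltnS.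
    apply/subset_leq_card/subsetP=> D; rewrite !inE => /andP[DL1 ->].
    rewrite andbT; apply/andP; split; first by apply: contraNneq DL1 => ->.
    by apply: contra DL1; apply: (subsetP sL).
  exists T, L'; split=> //; split=> //; rewrite !cardC // E.
  by rewrite inE CL1.
have f1f' : {in S, f1 =1 f} by move=> x xS; apply/eqP; apply: f1f.
have [T [L' [sT [[vT E nT] [_ CL']]]]] := learn_clause pw pu close_rest os wg f1f' nS.
(* The price released by [C] covers the whole tree of [learn_clause]. *)
exists T, L'; split=> //; split=> //; rewrite -(cardC _ CL') cardL mulnS.
by apply: leq_trans nT (leq_addl _ _).
Qed.

(** Branch on the block of the sink. A true sink falsifies ($\gamma$), whose guard is outside that
    block; a false sink gives an open state, as the sink has no outgoing edge. *)
Lemma refutation : exists T, [/\ concl T = set0, correct_inferences T, reg set0 T,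
  valid F set0 T
  & num_clauses T <= 2 ^ k * (standard_size + 4) + price * #|xor_Peb G k|].
Proof.
pose t := sink G; pose P := xor_Peb G k.
have job b L : True -> b = [ffun=> true] \/ True -> exists T L',
    [/\ correct_inferences T, reg (block_vars k (t |: set0)) T,
        blk t b :|: set0 \subset concl T & concl T \subset cl set0 (fun=> b) :|: blk t b]
    /\ learns P L T L' (standard_size + 3) /\ True.
  move=> _ _; case: (boolP (par b)) => pb.
    have CF := blk_sink_xor_Peb G pb.
    exists (unguard rho (blk t b)), (L :|: lemmas (unguard rho (blk t b))); split.
      split; rewrite ?(concl_unguard guard CF) ?setU0 ?subsetUr //.
        exact: unguard_correct.
      have E : cl [set t] (fun=> b) = blk t b by rewrite cl_blk.
      by rewrite /= inE -E guard_var // E.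
    split=> //; split=> //; first exact: unguard_valid.
    by apply: leq_add; [apply: leq_addl|rewrite leq_mul2l setD_mono ?orbT // subsetUl].
  have os : open_state [set t] t (fun=> b).
    split; rewrite ?set11 // => p r /set1P-> etr _.
    have /existsP[] : ~~ [forall w, ~~ edge t w].
      by rewrite negb_forall; apply/existsP; exists r; rewrite etr.
    by move=> w; have := sink_unique t; rewrite eqxx => /forallP ->.
  have [T [L' [[okT rT lT uT] lrT]]] := close_state L os.
  exists T, L'; split; last by split=> //; apply: learnsW lrT; apply: leq_addr.
  have E : cl [set t] (fun=> b) = blk t b by rewrite cl_blk.
  split; rewrite ?setU0 //; last by rewrite -E; apply: subset_trans uT (subsetUr _ _).
  rewrite -E; apply: subset_trans lT; apply: cl_sub.
  by rewrite sub1set frontier_goal ?set11.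
have [|||T [L' [[okT rT _ uT] [[vT E nT] _]]]] := @split_bits G k _ (learns P) (fun=> True)
  (fun=> True) (fun _ _ => I) (@learns_node P (fun=> True) (fun _ _ _ _ => I)) t set0 set0
  (fun=> [ffun=> true])
  [ffun=> true] (fun=> set0) (standard_size + 3) _ _ _ set0 I.
- by rewrite inE.
- by move=> b l; rewrite inE.
- by move=> b L _ _; have [T [L' [[h1 h2 h3 h4] h5]]] := job b L I (or_intror I);
    exists T, L'; split=> //; split=> //; apply: subset_trans h4 _; apply: setSU;
    apply/subsetP=> l; rewrite !inE.
exists T; split=> //.
- by apply/eqP; rewrite -subset0; apply: subset_trans uT _; apply/subsetP=> l; rewrite !inE.
- by apply: reg_sub rT; apply: sub0set.
apply: leq_trans (leq_addr _ _) (leq_trans nT _); rewrite setD0 leq_add2r.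
by apply: leq_trans (leq_pred _) _; rewrite leq_mul // -addnA.
Qed.

End Learning.

(** * The polynomial bound *)

Section Monomials.

Variable N : nat.
Hypothesis N_gt0 : 0 < N.

Lemma monomialD x y a b i j : x <= a * N ^ i -> y <= b * N ^ j ->
  x + y <= (a + b) * N ^ maxn i j.
Proof.
move=> xa yb; rewrite mulnDl leq_add //.
  by apply: leq_trans xa _; rewrite leq_mul2l leq_pexp2l ?leq_maxl ?orbT.
by apply: leq_trans yb _; rewrite leq_mul2l leq_pexp2l ?leq_maxr ?orbT.
Qed.

Lemma monomialM x y a b i j : x <= a * N ^ i -> y <= b * N ^ j ->
  x * y <= (a * b) * N ^ (i + j).
Proof. by move=> xa yb; rewrite expnD mulnACA leq_mul. Qed.

Lemma monomial_nat c : c <= c * N ^ 0.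
Proof. by rewrite muln1. Qed.

Lemma monomial1 x : x <= N -> x <= 1 * N ^ 1.
Proof. by rewrite mul1n. Qed.

End Monomials.

Lemma refutation_size_bound (G : pointed_dag) k N M :
  #|G| <= N -> 2 ^ k <= N -> M <= N ->
  2 ^ k * (standard_size G k + 4) + price G k * M <= 48 * N ^ 11.
Proof.
move=> nN qN MN; have kN : k < N by apply: leq_trans (ltn_expl k _) qN.
have N0 : 0 < N by apply: leq_ltn_trans kN.
rewrite /price /standard_size -(addn1 #|G|) /ecost.
move: #|G| (2 ^ k) nN qN => n q /monomial1 nN /monomial1 qN.
move/monomial1: MN => MN; move/ltnW/monomial1: kN => kN.
(* Monomial bounds are composed along the expression: [19 * N ^ 7] for [standard_size] and
   [25 * N ^ 10] for [price]. The two summands have coefficients 23 and 25 and degrees 8 and 11,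
   which gives 48 and 11. *)
eapply leq_trans.
  by repeat first [eassumption
    | refine (@monomialM N _ _ _ _ _ _ _ _)
    | refine (@monomialD N N0 _ _ _ _ _ _ _ _)
    | refine (@monomial_nat N _)].
by apply: leq_mul => //; rewrite leq_pexp2l.
Qed.

Theorem theorem6 :
  exists p : {poly nat},
  forall (G : pointed_dag) (k : nat)
         (rho : clause (xor_var G k) -> xor_var G k),
    0 < k -> guard_function rho ->
    exists t : rtree (xor_var G k),
      [/\ regRTI_refutation (GPeb rho) t,
          pool_refutation (GPeb rho) t
        & num_clauses t <= (p.[cnf_size (GPeb rho)])%R].
Proof.
exists ((48%N)%:P * 'X^11)%R => G k rho k_gt0 guard.
have [T [cT okT rT vT nT]] := refutation k_gt0 guard.
have iT := valid_input_lemmas vT.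
have pT : pool_refutation (GPeb rho) T.
  by split=> //; [apply: reg_regular|apply: input_pool_leaves].
exists T; split=> //.
rewrite hornerCM hornerXn natrXE natrME; apply: leq_trans nT _.
have sizeF := card_xor_Peb_GPeb guard.
apply: refutation_size_bound => //; apply: leq_trans sizeF.
  exact: card_vertex_xor_Peb.
exact: card_value_xor_Peb.
Qed.
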